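(* Identify the tense operators $F,G,P,H$ with $\Diamond,\Box,\dot{\Diamond},\blacksquare$, respectively. Then $\mathsf{IK}_t=\mathsf{Int2GC{+}FS}$; that is, a formula is provable in $\mathsf{IK}_t$ if and only if it is provable in $\mathsf{Int2GC{+}FS}$.
   Context: $\Phi$ is the set of formulas built from a countably infinite set $\mathit{Var}$ of propositional variables with the connectives $\neg,\vee,\wedge,\to$ and the unary operators $\Diamond,\Box,\dot{\Diamond},\blacksquare$. Put $\top:=p\to p$ for a fixed variable $p$, $\bot:=\neg\top$, $A\leftrightarrow B:=(A\to B)\wedge(B\to A)$. Axioms are understood as schemes. $\mathsf{Int2GC}$ is the smallest set of formulas of $\Phi$ that contains all instances (in the language $\Phi$) of theorems of intuitionistic propositional logic and is closed under modus ponens and the four rules: from $A\to\blacksquare B$ infer $\Diamond A\to B$; from $\Diamond A\to B$ infer $A\to\blacksquare B$; from $A\to\Box B$ infer $\dot{\Diamond} A\to B$; from $\dot{\Diamond} A\to B$ infer $A\to\Box B$. $\mathsf{Int2GC{+}FS}$ is the smallest extension of $\mathsf{Int2GC}$, closed under the same rules, containing the axioms (FS1) $\Diamond(A\to B)\to(\Box A\to\Diamond B)$ and (FS2) $\dot{\Diamond}(A\to B)\to(\blacksquare A\to\dot{\Diamond} B)$. $\mathsf{IK}_t$ (Ewald's intuitionistic tense logic) is formulated with unary operators $F,G,P,H$ over the intuitionistic propositional language. Its axioms are: (1) all axioms of intuitionistic logic; (2) $G(A\to B)\to(GA\to GB)$; (2$'$) $H(A\to B)\to(HA\to HB)$; (3)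 $G(A\wedge B)\leftrightarrow GA\wedge GB$; (3$'$) $H(A\wedge B)\leftrightarrow HA\wedge HB$; (4) $F(A\vee B)\leftrightarrow FA\vee FB$; (4$'$) $P(A\vee B)\leftrightarrow PA\vee PB$; (5) $G(A\to B)\to(FA\to FB)$; (5$'$) $H(A\to B)\to(PA\to PB)$; (6) $GA\wedge FB\to F(A\wedge B)$; (6$'$) $HA\wedge PB\to P(A\wedge B)$; (7) $G\neg A\to\neg FA$; (7$'$) $H\neg A\to\neg PA$; (8) $FHA\to A$; (8$'$) $PGA\to A$; (9) $A\to HFA$; (9$'$) $A\to GPA$; (10) $(FA\to GB)\to G(A\to B)$; (10$'$) $(PA\to HB)\to H(A\to B)$; (11) $F(A\to B)\to(GA\to FB)$; (11$'$) $P(A\to B)\to(HA\to PB)$. Its rules are modus ponens, from $A$ infer $HA$, and from $A$ infer $GA$. *)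

(* Defs.v *)
Inductive pform : Type :=
| PVar : nat -> pform
| PNeg : pform -> pform
| POr  : pform -> pform -> pform
| PAnd : pform -> pform -> pform
| PImp : pform -> pform -> pform.

(* Kleene's axiom schemes, with negation primitive. *)
Inductive IPL_axiom : pform -> Prop :=
| IPL_K A B : IPL_axiom (PImp A (PImp B A))
| IPL_S A B C :
    IPL_axiom (PImp (PImp A (PImp B C)) (PImp (PImp A B) (PImp A C)))
| IPL_andl A B : IPL_axiom (PImp (PAnd A B) A)
| IPL_andr A B : IPL_axiom (PImp (PAnd A B) B)
| IPL_andi A B : IPL_axiom (PImp A (PImp B (PAnd A B)))
| IPL_orl A B : IPL_axiom (PImp A (POr A B))
| IPL_orr A B : IPL_axiom (PImp B (POr A B))
| IPL_ore A B C :
    IPL_axiom (PImp (PImp A C) (PImp (PImp B C) (PImp (POr A B) C)))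
| IPL_negi A B : IPL_axiom (PImp (PImp A B) (PImp (PImp A (PNeg B)) (PNeg A)))
| IPL_nege A B : IPL_axiom (PImp (PNeg A) (PImp A B)).

Inductive IPL : pform -> Prop :=
| IPL_ax A : IPL_axiom A -> IPL A
| IPL_mp A B : IPL A -> IPL (PImp A B) -> IPL B.

Inductive formula : Type :=
| Var  : nat -> formula
| Neg  : formula -> formula
| Or   : formula -> formula -> formula
| And  : formula -> formula -> formula
| Imp  : formula -> formula -> formula
| Dia  : formula -> formula   (* white diamond *)
| Box  : formula -> formula   (* white box *)
| DDia : formula -> formula   (* dotted diamond *)
| BBox : formula -> formula.  (* black box *)

Declare Scope modal_scope.
Delimit Scope modal_scope with modal.
Bind Scope modal_scope with formula.

Notation "~ A" := (Neg A) : modal_scope.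
Notation "A \/ B" := (Or A B) : modal_scope.
Notation "A /\ B" := (And A B) : modal_scope.
Notation "A -> B" := (Imp A B) : modal_scope.

Definition Iff (A B : formula) : formula := ((A -> B) /\ (B -> A))%modal.

Notation "A <-> B" := (Iff A B) : modal_scope.

(* [inst s a], for all [s], are the instances of [a] in the modal language. *)
Fixpoint inst (s : nat -> formula) (a : pform) : formula :=
  match a with
  | PVar n => s n
  | PNeg a => Neg (inst s a)
  | POr a b => Or (inst s a) (inst s b)
  | PAnd a b => And (inst s a) (inst s b)
  | PImp a b => Imp (inst s a) (inst s b)
  end.

Inductive Int2GC : formula -> Prop :=
| Int2GC_int s a : IPL a -> Int2GC (inst s a)
| Int2GC_mp A B : Int2GC A -> Int2GC (A -> B) -> Int2GC B
| Int2GC_dia_intro A B : Int2GC (A -> BBox B) -> Int2GC (Dia A -> B)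
| Int2GC_bbox_intro A B : Int2GC (Dia A -> B) -> Int2GC (A -> BBox B)
| Int2GC_ddia_intro A B : Int2GC (A -> Box B) -> Int2GC (DDia A -> B)
| Int2GC_box_intro A B : Int2GC (DDia A -> B) -> Int2GC (A -> Box B).

Inductive Int2GC_FS : formula -> Prop :=
| Int2GC_FS_base A : Int2GC A -> Int2GC_FS A
| Int2GC_FS_FS1 A B : Int2GC_FS (Dia (A -> B) -> (Box A -> Dia B))
| Int2GC_FS_FS2 A B : Int2GC_FS (DDia (A -> B) -> (BBox A -> DDia B))
| Int2GC_FS_mp A B : Int2GC_FS A -> Int2GC_FS (A -> B) -> Int2GC_FS B
| Int2GC_FS_dia_intro A B :
    Int2GC_FS (A -> BBox B) -> Int2GC_FS (Dia A -> B)
| Int2GC_FS_bbox_intro A B :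
    Int2GC_FS (Dia A -> B) -> Int2GC_FS (A -> BBox B)
| Int2GC_FS_ddia_intro A B :
    Int2GC_FS (A -> Box B) -> Int2GC_FS (DDia A -> B)
| Int2GC_FS_box_intro A B :
    Int2GC_FS (DDia A -> B) -> Int2GC_FS (A -> Box B).

(* The tense operators F, G, P, H are identified with the modal ones, so that
   IK_t is a set of formulas of the same language. *)

Notation FF := Dia (only parsing).
Notation GG := Box (only parsing).
Notation PP := DDia (only parsing).
Notation HH := BBox (only parsing).

Inductive IKt_axiom : formula -> Prop :=
| IKt_1 s a : IPL_axiom a -> IKt_axiom (inst s a)
| IKt_2 A B : IKt_axiom (GG (A -> B) -> (GG A -> GG B))
| IKt_2' A B : IKt_axiom (HH (A -> B) -> (HH A -> HH B))
| IKt_3 A B : IKt_axiom (GG (A /\ B) <-> (GG A /\ GG B))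
| IKt_3' A B : IKt_axiom (HH (A /\ B) <-> (HH A /\ HH B))
| IKt_4 A B : IKt_axiom (FF (A \/ B) <-> (FF A \/ FF B))
| IKt_4' A B : IKt_axiom (PP (A \/ B) <-> (PP A \/ PP B))
| IKt_5 A B : IKt_axiom (GG (A -> B) -> (FF A -> FF B))
| IKt_5' A B : IKt_axiom (HH (A -> B) -> (PP A -> PP B))
| IKt_6 A B : IKt_axiom ((GG A /\ FF B) -> FF (A /\ B))
| IKt_6' A B : IKt_axiom ((HH A /\ PP B) -> PP (A /\ B))
| IKt_7 A : IKt_axiom (GG (~ A) -> ~ FF A)
| IKt_7' A : IKt_axiom (HH (~ A) -> ~ PP A)
| IKt_8 A : IKt_axiom (FF (HH A) -> A)
| IKt_8' A : IKt_axiom (PP (GG A) -> A)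
| IKt_9 A : IKt_axiom (A -> HH (FF A))
| IKt_9' A : IKt_axiom (A -> GG (PP A))
| IKt_10 A B : IKt_axiom ((FF A -> GG B) -> GG (A -> B))
| IKt_10' A B : IKt_axiom ((PP A -> HH B) -> HH (A -> B))
| IKt_11 A B : IKt_axiom (FF (A -> B) -> (GG A -> FF B))
| IKt_11' A B : IKt_axiom (PP (A -> B) -> (HH A -> PP B)).

Inductive IKt : formula -> Prop :=
| IKt_ax A : IKt_axiom A -> IKt A
| IKt_mp A B : IKt A -> IKt (A -> B) -> IKt B
| IKt_necH A : IKt A -> IKt (HH A)
| IKt_necG A : IKt A -> IKt (GG A).

(* Main.v *)
Require Import Defs.

(** Modulo provable equivalence, a set of formulas that contains intuitionistic
    logic and is closed under modus ponens is a Heyting algebra, ordered by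
    provable implication.  Both logics of the theorem describe the same
    structure on that algebra: Galois connections [Dia] -| [BBox] and
    [DDia] -| [Box], linked by the Fischer Servi laws
    [F (A -> B) <= G A -> F B] for the pairs [(Dia, Box)] and [(DDia, BBox)].
    This structure is [tense_structure] below.

    [IKt] has the structure ([IKt_tense_structure]): with necessitation,
    [IKt_2] makes [Box] monotone and [IKt_5] makes [Dia] monotone, [IKt_8] and
    [IKt_9] are the counit and unit of [Dia] -| [BBox], and [IKt_11] is a Fischer
    Servi law; the primed axioms do the same for the other operators.
    [Int2GC_FS] is the least logic with the structure ([Int2GC_FS_least]), hence
    it is included in [IKt].

    Conversely, every logic with the structure proves the [IKt] axioms.
    [IKt_2], [IKt_3], [IKt_4], [IKt_8] and [IKt_9] hold for any Galois
    connection.  [IKt_5], [IKt_6] and [IKt_7] follow by applying the monotone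
    operator [F] to an intuitionistic theorem of the form [A -> (B -> C)] and
    then using the Fischer Servi law of [F] and [G] ([fischer_servi_lift]);
    [IKt_10] uses the law of the other pair, [P] and [H] ([box_imp_intro]).  The
    structure is invariant under exchanging [F] with [P] and [G] with [H]
    ([tense_structure_mirror]), which gives the primed axioms.  Necessitation
    holds because the right adjoint in a Galois connection preserves truth
    ([galois_upper_nec]). *)

(** * Intuitionistic reasoning *)

Record intuitionistic (L : formula -> Prop) : Prop := {
  int_axiom : forall s a, IPL_axiom a -> L (inst s a);
  int_mp : forall A B, L A -> L (A -> B)%modal -> L B
}.

Arguments int_mp {L} _ {A B} _ _.

(** Three variables suffice to write each axiom scheme of [IPL_axiom], so the
    instances needed below are obtained from these substitutions. *)
Definition subst3 (A B C : formula) (n : nat) : formula :=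
  match n with 0 => A | 1 => B | _ => C end.

Lemma int_K L (iL : intuitionistic L) A B : L (A -> (B -> A))%modal.
Proof. exact (int_axiom L iL (subst3 A B A) _ (IPL_K (PVar 0) (PVar 1))). Qed.

Lemma int_S L (iL : intuitionistic L) A B C :
  L ((A -> (B -> C)) -> ((A -> B) -> (A -> C)))%modal.
Proof.
  exact (int_axiom L iL (subst3 A B C) _ (IPL_S (PVar 0) (PVar 1) (PVar 2))).
Qed.

Lemma and_left L (iL : intuitionistic L) A B : L (A /\ B -> A)%modal.
Proof. exact (int_axiom L iL (subst3 A B A) _ (IPL_andl (PVar 0) (PVar 1))). Qed.

Lemma and_right L (iL : intuitionistic L) A B : L (A /\ B -> B)%modal.
Proof. exact (int_axiom L iL (subst3 A B A) _ (IPL_andr (PVar 0) (PVar 1))). Qed.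

Lemma and_pair L (iL : intuitionistic L) A B : L (A -> (B -> A /\ B))%modal.
Proof. exact (int_axiom L iL (subst3 A B A) _ (IPL_andi (PVar 0) (PVar 1))). Qed.

Lemma or_left L (iL : intuitionistic L) A B : L (A -> A \/ B)%modal.
Proof. exact (int_axiom L iL (subst3 A B A) _ (IPL_orl (PVar 0) (PVar 1))). Qed.

Lemma or_right L (iL : intuitionistic L) A B : L (B -> A \/ B)%modal.
Proof. exact (int_axiom L iL (subst3 A B A) _ (IPL_orr (PVar 0) (PVar 1))). Qed.

Lemma neg_explode L (iL : intuitionistic L) A B : L (~ A -> (A -> B))%modal.
Proof. exact (int_axiom L iL (subst3 A B A) _ (IPL_nege (PVar 0) (PVar 1))). Qed.

Lemma imp_const L (iL : intuitionistic L) A B : L B -> L (A -> B)%modal.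
Proof. intros h; exact (int_mp iL h (int_K L iL B A)). Qed.

Lemma imp_app L (iL : intuitionistic L) C A B :
  L (C -> (A -> B))%modal -> L (C -> A)%modal -> L (C -> B)%modal.
Proof.
  intros hAB hA; exact (int_mp iL hA (int_mp iL hAB (int_S L iL C A B))).
Qed.

Lemma imp_refl L (iL : intuitionistic L) A : L (A -> A)%modal.
Proof.
  exact (imp_app L iL A (A -> A) A (int_K L iL A (A -> A)) (int_K L iL A A)).
Qed.

Lemma imp_trans L (iL : intuitionistic L) A B C :
  L (A -> B)%modal -> L (B -> C)%modal -> L (A -> C)%modal.
Proof.
  intros hAB hBC; apply (imp_app L iL A B C); [|exact hAB].
  now apply imp_const.
Qed.

Lemma and_intro L (iL : intuitionistic L) C A B :
  L (C -> A)%modal -> L (C -> B)%modal -> L (C -> A /\ B)%modal.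
Proof.
  intros hA hB; apply (imp_app L iL C B); [|exact hB].
  now apply (imp_trans L iL C A); [|apply and_pair].
Qed.

Lemma or_elim L (iL : intuitionistic L) A B C :
  L (A -> C)%modal -> L (B -> C)%modal -> L (A \/ B -> C)%modal.
Proof.
  intros hA hB; apply (int_mp iL hB), (int_mp iL hA).
  exact (int_axiom L iL (subst3 A B C) _ (IPL_ore (PVar 0) (PVar 1) (PVar 2))).
Qed.

Lemma curry L (iL : intuitionistic L) A B C :
  L (A /\ B -> C)%modal -> L (A -> (B -> C))%modal.
Proof.
  intros h; apply (imp_trans L iL A (B -> A /\ B)); [now apply and_pair|].
  exact (int_mp iL (imp_const L iL B _ h) (int_S L iL B (A /\ B) C)).
Qed.

Lemma uncurry L (iL : intuitionistic L) A B C :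
  L (A -> (B -> C))%modal -> L (A /\ B -> C)%modal.
Proof.
  intros h; apply (imp_app L iL _ B); [|now apply and_right].
  now apply (imp_trans L iL _ A); [apply and_left|].
Qed.

Lemma imp_swap L (iL : intuitionistic L) A B C :
  L (A -> (B -> C))%modal -> L (B -> (A -> C))%modal.
Proof.
  intros h; apply curry; [exact iL|].
  apply (imp_trans L iL _ (A /\ B)); [|now apply uncurry].
  apply and_intro; [exact iL | now apply and_right | now apply and_left].
Qed.

Lemma iff_intro L (iL : intuitionistic L) A B :
  L (A -> B)%modal -> L (B -> A)%modal -> L (A <-> B)%modal.
Proof. intros h1 h2; exact (int_mp iL h2 (int_mp iL h1 (and_pair L iL _ _))). Qed.

(** Since [A -> A] holds, the axiom [(A -> A) -> ((A -> ~ A) -> ~ A)] turns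
    self-refutation into negation.  This introduces a negation without
    mentioning falsity. *)
Lemma neg_of_imp_neg L (iL : intuitionistic L) C A :
  L (C -> (A -> ~ A))%modal -> L (C -> ~ A)%modal.
Proof.
  intros h; apply (imp_trans L iL C (A -> ~ A)); [exact h|].
  apply (int_mp iL (imp_refl L iL A)).
  exact (int_axiom L iL (subst3 A A A) _ (IPL_negi (PVar 0) (PVar 1))).
Qed.

(** * Galois connections *)

Definition galois (L : formula -> Prop) (F H : formula -> formula) : Prop :=
  forall A B, L (F A -> B)%modal <-> L (A -> H B)%modal.

Lemma galois_counit L (iL : intuitionistic L) F H (gFH : galois L F H) A :
  L (F (H A) -> A)%modal.
Proof. now apply gFH, imp_refl. Qed.

Lemma galois_unit L (iL : intuitionistic L) F H (gFH : galois L F H) A :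
  L (A -> H (F A))%modal.
Proof. now apply gFH, imp_refl. Qed.

Lemma galois_lower_mono L (iL : intuitionistic L) F H (gFH : galois L F H) A B :
  L (A -> B)%modal -> L (F A -> F B)%modal.
Proof.
  intros h; apply gFH, (imp_trans L iL A B); [exact h|].
  now apply galois_unit.
Qed.

Lemma galois_upper_mono L (iL : intuitionistic L) F H (gFH : galois L F H) A B :
  L (A -> B)%modal -> L (H A -> H B)%modal.
Proof.
  intros h; apply gFH, (imp_trans L iL _ A); [|exact h].
  now apply galois_counit.
Qed.

Lemma galois_upper_nec L (iL : intuitionistic L) F H (gFH : galois L F H) A :
  L A -> L (H A).
Proof.
  intros h; apply (int_mp iL (imp_refl L iL A)), gFH.
  now apply imp_const.
Qed.

(** A conjunction under [H] is reached through the connection, since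
    [F (H A /\ H B)] is below both [F (H A) <= A] and [F (H B) <= B]. *)
Lemma galois_upper_and_intro L (iL : intuitionistic L) F H
    (gFH : galois L F H) A B :
  L (H A /\ H B -> H (A /\ B))%modal.
Proof.
  apply gFH, and_intro; [exact iL | |]; apply gFH.
  - now apply and_left.
  - now apply and_right.
Qed.

Lemma galois_upper_and L (iL : intuitionistic L) F H (gFH : galois L F H) A B :
  L (H (A /\ B) <-> (H A /\ H B))%modal.
Proof.
  apply iff_intro; [exact iL | | now apply (galois_upper_and_intro L iL F)].
  apply and_intro; [exact iL | |];
    apply (galois_upper_mono L iL F H gFH); [now apply and_left | now apply and_right].
Qed.

Lemma galois_lower_or L (iL : intuitionistic L) F H (gFH : galois L F H) A B :
  L (F (A \/ B) <-> (F A \/ F B))%modal.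
Proof.
  apply iff_intro; [exact iL | |].
  - apply gFH, or_elim; [exact iL | |]; apply gFH.
    + now apply or_left.
    + now apply or_right.
  - apply or_elim; [exact iL | |];
      apply (galois_lower_mono L iL F H gFH); [now apply or_left | now apply or_right].
Qed.

Lemma galois_upper_imp L (iL : intuitionistic L) F H (gFH : galois L F H) A B :
  L (H (A -> B) -> (H A -> H B))%modal.
Proof.
  apply curry; [exact iL|].
  apply (imp_trans L iL _ (H ((A -> B) /\ A)%modal)).
  - now apply (galois_upper_and_intro L iL F).
  - apply (galois_upper_mono L iL F H gFH).
    now apply uncurry, imp_refl.
Qed.

(** * The Fischer Servi laws *)

Definition fischer_servi (L : formula -> Prop) (F G : formula -> formula) : Prop :=
  forall A B, L (F (A -> B) -> (G A -> F B))%modal.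

(** The law turns an intuitionistic [A -> (B -> C)] into a modal implication
    with one premise possible and the other necessary; [dia_mono_under_box],
    [box_and_dia] and [box_neg] are the cases of modus ponens, pairing and
    contradiction. *)
Lemma fischer_servi_lift L (iL : intuitionistic L) F G H
    (gFH : galois L F H) (fs : fischer_servi L F G) A B C :
  L (A -> (B -> C))%modal -> L (F A -> (G B -> F C))%modal.
Proof.
  intros h; apply (imp_trans L iL _ (F (B -> C)%modal)); [|apply fs].
  now apply (galois_lower_mono L iL F H).
Qed.

Lemma dia_mono_under_box L (iL : intuitionistic L) F G H
    (gFH : galois L F H) (fs : fischer_servi L F G) A B :
  L (G (A -> B) -> (F A -> F B))%modal.
Proof.
  apply imp_swap, (fischer_servi_lift L iL F G H gFH fs); [exact iL|].
  now apply imp_swap, imp_refl.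
Qed.

Lemma box_and_dia L (iL : intuitionistic L) F G H
    (gFH : galois L F H) (fs : fischer_servi L F G) A B :
  L ((G A /\ F B) -> F (A /\ B))%modal.
Proof.
  apply uncurry, imp_swap, (fischer_servi_lift L iL F G H gFH fs); try exact iL.
  now apply imp_swap, and_pair.
Qed.

(** [A] and [~ A] imply everything, in particular [H (~ F A)]; and
    [F (H (~ F A))] gives back [~ F A].  Thus [G (~ A)] makes [F A] refute
    itself. *)
Lemma box_neg L (iL : intuitionistic L) F G H
    (gFH : galois L F H) (fs : fischer_servi L F G) A :
  L (G (~ A) -> ~ F A)%modal.
Proof.
  apply neg_of_imp_neg, imp_swap, curry; try exact iL.
  apply (imp_trans L iL _ (F (H (~ F A)%modal))); [|now apply galois_counit].
  apply uncurry, (fischer_servi_lift L iL F G H gFH fs); [exact iL|].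
  now apply imp_swap, neg_explode.
Qed.

(** By [P -| G] it suffices to derive [B] from [P (F A -> G B)] and [A].  The
    unit turns [A] into [H (F A)], so the Fischer Servi law of [P] and [H]
    yields [P (G B)], which is below [B]. *)
Lemma box_imp_intro L (iL : intuitionistic L) F G P H
    (gFH : galois L F H) (gPG : galois L P G) (fs : fischer_servi L P H) A B :
  L ((F A -> G B) -> G (A -> B))%modal.
Proof.
  apply gPG, curry; [exact iL|].
  apply (imp_trans L iL _ (P (G B))); [|now apply galois_counit].
  apply (imp_app L iL _ (H (F A))).
  - apply (imp_trans L iL _ (P (F A -> G B)%modal)); [now apply and_left | apply fs].
  - apply (imp_trans L iL _ A); [now apply and_right | now apply galois_unit].
Qed.

(** * Tense structures *)

Record tense_structure (L : formula -> Prop) (F G P H : formula -> formula) :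
    Prop := {
  ts_int : intuitionistic L;
  ts_FH : galois L F H;
  ts_PG : galois L P G;
  ts_FG : fischer_servi L F G;
  ts_PH : fischer_servi L P H
}.

Lemma tense_structure_mirror L F G P H :
  tense_structure L F G P H -> tense_structure L P H F G.
Proof. intros []; now constructor. Qed.

(** Only the unprimed axioms are proved, for arbitrary operators; the primed ones
    are the same statements about the mirrored structure. *)
Lemma IKt_axiom_sound L :
  tense_structure L Dia Box DDia BBox -> forall A, IKt_axiom A -> L A.
Proof.
  assert (half : forall F G P H, tense_structure L F G P H ->
    (forall A B, L (G (A -> B) -> (G A -> G B))%modal) /\
    (forall A B, L (G (A /\ B) <-> (G A /\ G B))%modal) /\
    (forall A B, L (F (A \/ B) <-> (F A \/ F B))%modal) /\
    (forall A B, L (G (A -> B) -> (F A -> F B))%modal) /\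
    (forall A B, L ((G A /\ F B) -> F (A /\ B))%modal) /\
    (forall A, L (G (~ A) -> ~ F A)%modal) /\
    (forall A, L (F (H A) -> A)%modal) /\
    (forall A, L (A -> H (F A))%modal) /\
    (forall A B, L ((F A -> G B) -> G (A -> B))%modal) /\
    (forall A B, L (F (A -> B) -> (G A -> F B))%modal)).
  { intros F G P H [iL gFH gPG fFG fPH]; repeat split; intros.
    - now apply (galois_upper_imp L iL P).
    - now apply (galois_upper_and L iL P).
    - now apply (galois_lower_or L iL F H).
    - now apply (dia_mono_under_box L iL F G H).
    - now apply (box_and_dia L iL F G H).
    - now apply (box_neg L iL F G H).
    - now apply galois_counit.
    - now apply galois_unit.
    - now apply (box_imp_intro L iL F G P H).
    - apply fFG. }
  intros ts.
  pose proof (half _ _ _ _ ts) as future.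
  pose proof (half _ _ _ _ (tense_structure_mirror _ _ _ _ _ ts)) as past.
  intros A [s a ha | | | | | | | | | | | | | | | | | | | |];
    [ now apply (int_axiom L (ts_int _ _ _ _ _ ts)) | .. ];
    first [apply future | apply past].
Qed.

Lemma Int2GC_FS_tense_structure : tense_structure Int2GC_FS Dia Box DDia BBox.
Proof.
  split.
  - split.
    + intros s a ha; now apply Int2GC_FS_base, Int2GC_int, IPL_ax.
    + exact Int2GC_FS_mp.
  - intros A B; split; [apply Int2GC_FS_bbox_intro | apply Int2GC_FS_dia_intro].
  - intros A B; split; [apply Int2GC_FS_box_intro | apply Int2GC_FS_ddia_intro].
  - exact Int2GC_FS_FS1.
  - exact Int2GC_FS_FS2.
Qed.

Lemma galois_of_unit_counit L (iL : intuitionistic L) F H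
    (monoF : forall A B, L (A -> B)%modal -> L (F A -> F B)%modal)
    (monoH : forall A B, L (A -> B)%modal -> L (H A -> H B)%modal)
    (unit : forall A, L (A -> H (F A))%modal)
    (counit : forall A, L (F (H A) -> A)%modal) :
  galois L F H.
Proof.
  intros A B; split; intros h.
  - apply (imp_trans L iL A (H (F A))); [apply unit | now apply monoH].
  - apply (imp_trans L iL _ (F (H B))); [now apply monoF | apply counit].
Qed.

Lemma IKt_tense_structure : tense_structure IKt Dia Box DDia BBox.
Proof.
  assert (iL : intuitionistic IKt).
  { split; [|exact IKt_mp].
    intros s a ha; now apply IKt_ax, IKt_1. }
  split.
  - exact iL.
  - apply (galois_of_unit_counit IKt iL); intros.
    + now apply (int_mp iL (IKt_necG _ H)), IKt_ax, IKt_5.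
    + now apply (int_mp iL (IKt_necH _ H)), IKt_ax, IKt_2'.
    + apply IKt_ax, IKt_9.
    + apply IKt_ax, IKt_8.
  - apply (galois_of_unit_counit IKt iL); intros.
    + now apply (int_mp iL (IKt_necH _ H)), IKt_ax, IKt_5'.
    + now apply (int_mp iL (IKt_necG _ H)), IKt_ax, IKt_2.
    + apply IKt_ax, IKt_9'.
    + apply IKt_ax, IKt_8'.
  - intros A B; apply IKt_ax, IKt_11.
  - intros A B; apply IKt_ax, IKt_11'.
Qed.

Lemma Int2GC_least L (ts : tense_structure L Dia Box DDia BBox) A :
  Int2GC A -> L A.
Proof.
  destruct ts as [iL gFH gPG _ _].
  induction 1 as [s a ha | A B _ hA _ hAB | A B _ h | A B _ h | A B _ h | A B _ h].
  - induction ha as [a ha | a b _ hA _ hAB].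
    + now apply int_axiom.
    + exact (int_mp iL hA hAB).
  - exact (int_mp iL hA hAB).
  - now apply gFH.
  - now apply gFH.
  - now apply gPG.
  - now apply gPG.
Qed.

Lemma Int2GC_FS_least L (ts : tense_structure L Dia Box DDia BBox) A :
  Int2GC_FS A -> L A.
Proof.
  pose proof ts as [iL gFH gPG fFG fPH].
  induction 1 as [A h | A B | A B | A B _ hA _ hAB
                 | A B _ h | A B _ h | A B _ h | A B _ h].
  - now apply Int2GC_least.
  - apply fFG.
  - apply fPH.
  - exact (int_mp iL hA hAB).
  - now apply gFH.
  - now apply gFH.
  - now apply gPG.
  - now apply gPG.
Qed.

Theorem theorem2p6 : forall A : formula, IKt A <-> Int2GC_FS A.
Proof.
  pose proof Int2GC_FS_tense_structure as ts.
  intros A; split.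
  - induction 1 as [A h | A B _ hA _ hAB | A _ h | A _ h].
    + now apply (IKt_axiom_sound _ ts).
    + now apply Int2GC_FS_mp with A.
    + now apply (galois_upper_nec _ (ts_int _ _ _ _ _ ts) _ _ (ts_FH _ _ _ _ _ ts)).
    + now apply (galois_upper_nec _ (ts_int _ _ _ _ _ ts) _ _ (ts_PG _ _ _ _ _ ts)).
  - exact (Int2GC_FS_least _ IKt_tense_structure A).
Qed.
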